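(* Let $F=\{a_1,\dots,a_m\}$ be an arbitrary finite field with $|F|=m$ elements, where $a_1=0$. Let $A\in M_{m+3}(F)$ be the direct sum of the following $m+1$ Jordan blocks: $$A=J_3(0)\oplus J_1(0)\oplus J_1(a_2)\oplus\cdots\oplus J_1(a_m).$$ Then $A$ is not of polynomial type, that is, there are no polynomials $f,g\in F[X]$, with $f$ monic of degree $m+3$, such that $A$ is similar to $g(C_f)$.
   Context: $J_k(a)$ denotes the $k\times k$ Jordan block with eigenvalue $a$. For monic $f=f_0+f_1X+\cdots+f_{n-1}X^{n-1}+X^n\in F[X]$ the companion matrix $C_f\in M_n(F)$ has $1$'s on the first subdiagonal, last column $(-f_0,\dots,-f_{n-1})^T$, and $0$'s elsewhere. *)

(* Defs.v *)
From mathcomp Require Import all_boot all_order all_algebra.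

Set Implicit Arguments.
Unset Strict Implicit.
Unset Printing Implicit Defensive.

Import GRing.Theory.
Local Open Scope ring_scope.

(* Convention: the 1's of a Jordan block lie on the superdiagonal. *)
Definition jordan_block (R : nzRingType) (k : nat) (a : R) : 'M[R]_k :=
  \matrix_(i, j) (a *+ (i == j) + (i.+1 == j :> nat)%:R).

(* The library's companionmx is the transpose (coefficients in the last row), *)
(* and its dimension is (size f).-1 instead of a parameter; see companionE.   *)
Definition companion (R : nzRingType) (n : nat) (f : {poly R}) : 'M[R]_n :=
  \matrix_(i, j) if j == n.-1 :> nat then - f`_i else (i == j.+1 :> nat)%:R.

Lemma companionE (R : nzRingType) (f : {poly R}) :
  companion (size f).-1 f = (companionmx f)^T.
Proof. by apply/matrixP => i j; rewrite !mxE [(j.+1 == i)%N]eq_sym. Qed.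

(* The dimension is a successor because horner_mx, which evaluates g at a     *)
(* matrix, needs 'M_n to be a nontrivial ring.                                *)
Definition polynomial_type (F : fieldType) (n : nat) (A : 'M[F]_n.+1) : Prop :=
  exists f g : {poly F},
    [/\ f \is monic, size f = n.+2
      & similar_in unitmx A (horner_mx (companion n.+1 f) g)].

Fact block_dim (k : nat) :
  (3 + (1 + \sum_(i < k) 1) = k.+1.+3)%N.
Proof. by rewrite sum1_card card_ord. Qed.

(* J_3(0) (+) J_1(0) (+) J_1(a_2) (+) ... (+) J_1(a_m), where m = k.+1 and    *)
(* a_1, ..., a_m are a 0, ..., a k; the cast only turns the sum of the block  *)
(* sizes into m + 3.                                                          *)
Definition jordan_sum (R : nzRingType) (k : nat) (a : 'I_k.+1 -> R) :
    'M[R]_(k.+1.+3) :=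
  castmx (block_dim k, block_dim k)
    (block_mx (jordan_block 3 0) 0
              0 (block_mx (jordan_block 1 0) 0
                          0 (\mxdiag_(i < k) jordan_block 1 (a (lift ord0 i))))).

(* Main.v *)
Require Import Defs.
From mathcomp Require Import all_boot all_order all_algebra.
From mathcomp Require Import zify.

Set Implicit Arguments.
Unset Strict Implicit.
Unset Printing Implicit Defensive.

Import GRing.Theory.
Local Open Scope ring_scope.

(** Suppose that A is similar to g(C_f). Everything is read off from the ranks
    of polynomials in A: dim ker h(C_f) = deg gcd(f, h) for every polynomial h
    ([rank_horner_companion]), while the block structure of A gives
    dim ker A^j = j + 1 for j = 1, 2, 3 and dim ker (A - c) = 1 for c <> 0
    ([rank_horner_jordan_sum]). Hence gcd(f, g^j) has degree j + 1 for
    j = 1, 2, 3, and gcd(f, g - c) has degree 1 for every nonzero c in F.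

    These degrees are contradictory ([gcdp_sizes_absurd]). A gcd of degree 1
    has a root in F, so g takes every nonzero value on F. Put
    d_j = gcd(f, g^j). Since d_1 | d_2 | d_3 have degrees 2, 3, 4, the quotients
    d_2 / d_1 and d_3 / d_2 are linear, and their roots are roots of g in F. So
    g : F -> F is onto, and F being finite, it is one-to-one: g has exactly one
    root b in F, which is the root of both quotients. In particular b is a
    common root of f and g, so X - b divides d_1, and the remaining linear
    factor of d_1 is again X - b. Up to constants, d_1 = (X - b)^2 and
    d_3 = (X - b)^4. So (X - b)^4 divides f, and it divides g^2 because
    (X - b)^2 divides g; hence it divides d_2, whose degree is 3. *)

(** * Ranks of polynomials in a companion matrix *)

Lemma horner_mx_tr (R : comNzRingType) (n : nat) (A : 'M[R]_n.+1)
    (p : {poly R}) :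
  horner_mx A^T p = (horner_mx A p)^T.
Proof.
elim/poly_ind: p => [|p c IHp]; first by rewrite !rmorph0 trmx0.
rewrite [in LHS]mulrC !rmorphD !rmorphM /= !horner_mx_C !horner_mx_X.
by rewrite linearD /= [in RHS]trmx_mul tr_scalar_mx IHp.
Qed.

Lemma companion_root (R : comNzRingType) (n : nat) (f : {poly R}) :
  f \is monic -> size f = n.+2 -> horner_mx (companion n.+1 f) f = 0.
Proof.
move=> f_monic size_f.
(* The library's companion matrix has dimension (size f).-1, so the dimension
   is first made a variable. *)
suff char_f N : N = (size f).-1 -> char_poly (companion N f) = f.
  by rewrite -{2}(char_f n.+1) ?size_f // Cayley_Hamilton.
by move->; rewrite companionE -[RHS]companionmxK // /char_poly -[RHS]det_tr;
   congr (\det _); rewrite /char_poly_mx linearB /= tr_scalar_mx map_trmx.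
Qed.

Section RankCompanion.

Variables (F : fieldType) (n : nat) (f : {poly F}).
Local Notation C := (companion n.+1 f).

(** The row vector e_0 is cyclic for the transpose of C: applying p(C^T) to it
    yields the coefficients of p, as long as deg p <= n. *)
Lemma delta_horner_companion (p : {poly F}) :
  (size p <= n.+1)%N -> delta_mx 0 0 *m horner_mx C^T p = poly_rV p :> 'rV_n.+1.
Proof.
have CX (i : nat) : (i < n.+1)%N ->
    delta_mx 0 0 *m (C^T) ^+ i = poly_rV 'X^i :> 'rV_n.+1.
  elim: i => [|i IHi] lt_i.
    by rewrite expr0 mulmx1; apply/rowP => j; rewrite !mxE coefXn eqxx.
  rewrite exprSr [_ ^+ _ * _]/(_ *m _) mulmxA IHi ?(ltnW lt_i) //.
  have -> : poly_rV 'X^i = delta_mx 0 (Ordinal (ltnW lt_i)) :> 'rV[F]_n.+1.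
    by apply/rowP => j; rewrite !mxE coefXn eqxx.
  rewrite -rowE; apply/rowP => j; rewrite !mxE coefXn /=.
  (* As i < n, row i of C^T is not the one that holds the coefficients. *)
  by rewrite ltn_eqF.
move=> size_p; rewrite -[p in LHS]coefK poly_def.
rewrite linear_sum mulmx_sumr -[p in RHS]coefK poly_def linear_sum.
apply: eq_bigr => i _; rewrite !linearZ /= rmorphXn /= horner_mx_X.
by rewrite CX // (leq_trans (ltn_ord i)).
Qed.

(** Up to transposition, the row space of p(C) contains the coefficient rows of
    X^i p for i < n + 1 - deg p, and these are linearly independent. *)
Lemma rank_horner_companion_ge (p : {poly F}) : p != 0 ->
  (n.+2 - size p <= \rank (horner_mx C p))%N.
Proof.
move=> p_neq0; rewrite -mxrank_tr -horner_mx_tr; set d := (_ - _)%N.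
have size_mulp (v : 'rV[F]_d) : (size (rVpoly v * p)%R <= n.+1)%N.
  have [->|v_neq0] := eqVneq (rVpoly v) 0; first by rewrite mul0r size_poly0.
  rewrite size_mul // -ltnS prednK ?addn_gt0 ?size_poly_gt0 ?v_neq0 //.
  have := size_poly d (fun k => if insub k is Some i then v 0 i else 0).
  rewrite -/(rVpoly v) => size_v; have := v_neq0; rewrite -size_poly_gt0.
  move: size_v; rewrite /d => size_v size_v_gt0.
  have lt_p : (size p <= n.+2)%N.
    by rewrite ltnW // -subn_gt0; apply: leq_trans size_v_gt0 size_v.
  by apply: leq_trans (leq_add size_v (leqnn _)) _; rewrite subnK.
pose M : 'M[F]_(d, n.+1) := \matrix_i poly_rV ('X^i * p).
have vM (v : 'rV[F]_d) : v *m M = poly_rV (rVpoly v * p).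
  rewrite mulmx_sum_row [rVpoly v]poly_def mulr_suml linear_sum.
  by apply: eq_bigr => i _; rewrite rowK valK -scalerAl linearZ.
have M_free : row_free M.
  apply: inj_row_free => v; rewrite vM => /(congr1 rVpoly).
  rewrite poly_rV_K // linear0 => /eqP; rewrite mulf_eq0 (negPf p_neq0) orbF.
  by move/eqP=> v0; rewrite -[v]rVpolyK v0 linear0.
move/eqP: M_free => <-; apply: mxrankS; apply/row_subP => i.
have -> : row i M = poly_rV 'X^i *m horner_mx C^T p.
  have lt_i : (i < n.+1)%N.
    have := ltn_ord i; rewrite /d ltn_subRL => lt_i.
    rewrite -ltnS; apply: leq_ltn_trans lt_i.
    by rewrite -add1n leq_add2r size_poly_gt0.
  rewrite -delta_horner_companion ?size_polyXn // -mulmxA.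
  rewrite [_ *m horner_mx _ p](esym (rmorphM (horner_mx _) _ _)).
  rewrite delta_horner_companion ?rowK //.
  by have := size_mulp (delta_mx 0 i); rewrite rVpoly_delta.
exact: submxMl.
Qed.

Hypotheses (f_monic : f \is monic) (size_f : size f = n.+2).

(** If f = h d then h(C) d(C) = 0, so the ranks of h(C) and d(C) add up to at
    most n + 1; the two lower bounds already add up to n + 1. *)
Lemma rank_horner_companion_dvd (d : {poly F}) :
  d %| f -> (\rank (horner_mx C d) = n.+2 - size d)%N.
Proof.
have f_neq0 := monic_neq0 f_monic.
case/dvdpP=> h f_hd.
have /andP[h_neq0 d_neq0] : (h != 0) && (d != 0).
  by rewrite -negb_or -mulf_eq0 -f_hd.
have hd0 : horner_mx C h *m horner_mx C d = 0.
  by have := companion_root f_monic size_f; rewrite {2}f_hd rmorphM.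
have size_hd : (size h + size d).-1 = n.+2 by rewrite -size_mul // -f_hd.
have := mulmx0_rank_max hd0.
have := rank_horner_companion_ge h_neq0.
have := rank_horner_companion_ge d_neq0.
move: h_neq0 d_neq0; rewrite -!size_poly_gt0; lia.
Qed.

(** Since size is degree plus one, this says dim ker p(C) = deg gcd(f, p). *)
Lemma rank_horner_companion (p : {poly F}) :
  (\rank (horner_mx C p) = n.+2 - size (gcdp f p))%N.
Proof.
rewrite -rank_horner_companion_dvd ?dvdp_gcdl //.
apply/eqP; rewrite eqn_leq; apply/andP; split.
  have /dvdpP[q {1}->] := dvdp_gcdr f p.
  by rewrite rmorphM; apply: mxrankM_maxr.
have [[u v] /= uv] := Bezoutp f p.
have /eqpP[[a b] /= /andP[a_neq0 b_neq0] ab] := uv.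
have gcdE : gcdp f p = (b^-1 * a) *: (u * f + v * p).
  by rewrite -scalerA ab scalerA mulVf ?scale1r.
rewrite gcdE linearZ rmorphD !rmorphM /= (companion_root f_monic size_f).
rewrite mulr0 add0r.
by apply: leq_trans (mxrank_scale _ _) _; apply: mxrankM_maxr.
Qed.

End RankCompanion.

(** * Ranks of polynomials in the Jordan matrix *)

Lemma rank_horner_similar (F : fieldType) (n : nat) (A B : 'M[F]_n.+1)
    (p : {poly F}) :
  similar_in unitmx A B -> \rank (horner_mx A p) = \rank (horner_mx B p).
Proof.
case=> P P_unit /(similarRL P_unit) ->; rewrite horner_mx_uconj //.
rewrite mxrankMfree ?row_free_unit ?unitmx_inv //.
by rewrite (eqmxMfull _ (_ : row_full P)) ?row_full_unit.
Qed.

Lemma mul_mxdiag_mxdiag (R : pzSemiRingType) (m : nat) (p : 'I_m -> nat)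
    (B D : forall i, 'M[R]_(p i)) :
  \mxdiag_i B i *m \mxdiag_i D i = \mxdiag_i (B i *m D i).
Proof.
rewrite [X in _ *m X]/mxdiag mul_mxdiag_mxblock; apply/eq_mxblock => i j.
by case: eqVneq => [<-|_]; rewrite ?conform_mx_id ?mulmx0.
Qed.

Section RankJordan.

Variables (R : comNzRingType) (k : nat).

(** The direct sum of a block of size 3, a block of size 1 and k further blocks
    of size 1, cast to size k + 4 exactly as in [jordan_sum]. *)
Definition block_sum (B : 'M[R]_3) (c : 'M[R]_1) (d : 'I_k -> 'M[R]_1) :
    'M[R]_(k.+1.+3) :=
  castmx (block_dim k, block_dim k)
    (block_mx B 0 0 (block_mx c 0 0 (\mxdiag_(i < k) d i))).

Lemma block_sumD B B' c c' d d' :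
  block_sum B c d + block_sum B' c' d' =
  block_sum (B + B') (c + c') (fun i => d i + d' i).
Proof.
rewrite /block_sum; case: _ / (block_dim k); rewrite !castmx_id.
by rewrite !add_block_mx !addr0 mxdiagD.
Qed.

Lemma block_sumM B B' c c' d d' :
  block_sum B c d *m block_sum B' c' d' =
  block_sum (B *m B') (c *m c') (fun i => d i *m d' i).
Proof.
rewrite /block_sum; case: _ / (block_dim k); rewrite !castmx_id.
rewrite !mulmx_block !(mulmx0, mul0mx, addr0, add0r).
by congr (block_mx _ _ _ (block_mx _ _ _ _)); rewrite mul_mxdiag_mxdiag.
Qed.

Lemma block_sum_scalar (x : R) : block_sum x%:M x%:M (fun=> x%:M) = x%:M.
Proof.
rewrite /block_sum mxdiagZ -!scalar_mx_block.
by case: _ / (block_dim k); rewrite castmx_id.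
Qed.

Lemma horner_block_sum B c d (p : {poly R}) :
  horner_mx (block_sum B c d) p =
  block_sum (horner_mx B p) (horner_mx c p) (fun i => horner_mx (d i) p).
Proof.
have horner_mxMXaddC m (A : 'M[R]_m.+1) (q : {poly R}) x :
    horner_mx A (q * 'X + x%:P) = horner_mx A q *m A + x%:M.
  by rewrite rmorphD rmorphM /= horner_mx_X horner_mx_C.
elim/poly_ind: p => [|p x IHp].
  have M0 m : (0 : 'M[R]_m) = 0%:M by rewrite raddf0.
  (* The zero matrix is treated as a scalar matrix. *)
  rewrite rmorph0 [LHS]M0 -block_sum_scalar.
  congr (castmx _ (block_mx _ _ _ (block_mx _ _ _ _)));
    rewrite -?M0 ?rmorph0 //.
  by apply/eq_mxdiag => i; rewrite rmorph0.
rewrite !horner_mxMXaddC IHp block_sumM -block_sum_scalar block_sumD.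
congr (castmx _ (block_mx _ _ _ (block_mx _ _ _ _))).
by apply/eq_mxdiag => i; rewrite horner_mxMXaddC.
Qed.

End RankJordan.

Lemma rank_block_sum (F : fieldType) (k : nat) (B : 'M[F]_3) (c : 'M_1)
    (d : 'I_k -> 'M_1) :
  (\rank (block_sum B c d) = \rank B + (\rank c + \sum_i \rank (d i)))%N.
Proof.
rewrite -rank_mxdiag -!rank_diag_block_mx /block_sum.
by case: _ / (block_dim k); rewrite castmx_id.
Qed.

Lemma jordan_block1 (R : nzRingType) (x : R) : jordan_block 1 x = x%:M.
Proof. by apply/matrixP => i j; rewrite !ord1 !mxE !eqxx addr0. Qed.

Lemma horner_mx_scalar (R : comNzRingType) (n : nat) (x : R) (p : {poly R}) :
  horner_mx (x%:M : 'M_n.+1) p = (p.[x])%:M.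
Proof.
elim/poly_ind: p => [|p y IHp]; first by rewrite rmorph0 horner0 raddf0.
rewrite rmorphD rmorphM /= horner_mx_X horner_mx_C IHp hornerMXaddC.
by rewrite raddfD /= scalar_mxM.
Qed.

Lemma jordan_block_nilp (R : nzRingType) (n : nat) :
  jordan_block n.+1 (0 : R) = (companion n.+1 'X^(n.+1))^T.
Proof.
apply/matrixP => i j; rewrite !mxE mul0rn add0r coefXn /=.
have [->|_] := eqVneq (i : nat) n; last by rewrite eq_sym.
by rewrite [n.+1 == _]eq_sym ltn_eqF // oppr0.
Qed.

(** This is the companion case with f = X^(n+1). *)
Lemma rank_horner_jordan_block_nilp (F : fieldType) (n : nat) (p : {poly F}) :
  (\rank (horner_mx (jordan_block n.+1 0) p) =
     n.+2 - size (gcdp 'X^(n.+1) p))%N.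
Proof.
rewrite jordan_block_nilp horner_mx_tr mxrank_tr.
by rewrite rank_horner_companion ?monicXn ?size_polyXn.
Qed.

(** The block of size 3 contributes 3 - deg gcd(X^3, p); the blocks of size 1
    have each element of F exactly once as eigenvalue, and the one with
    eigenvalue x contributes 1 unless p(x) = 0. *)
Lemma rank_horner_jordan_sum (F : finFieldType) (k : nat) (a : 'I_k.+1 -> F)
    (p : {poly F}) :
  bijective a -> a ord0 = 0 ->
  (\rank (horner_mx (jordan_sum a) p) =
     4 - size (gcdp 'X^3 p) + #|[pred x | ~~ root p x]|)%N.
Proof.
move=> a_bij a0; rewrite [jordan_sum a]/(block_sum _ _ _) horner_block_sum.
rewrite rank_block_sum rank_horner_jordan_block_nilp; congr (_ + _)%N.
have rank1 x : \rank (horner_mx (jordan_block 1 x) p) = ~~ root p x.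
  rewrite jordan_block1 horner_mx_scalar rank_rV -scalemx1 scaler_eq0.
  by rewrite oner_eq0 orbF.
rewrite -sum1_card (reindex a (onW_bij _ a_bij)) [RHS]big_mkcond big_ord_recl.
rewrite a0 rank1 inE.
by congr addn; apply: eq_bigr => i _; rewrite rank1.
Qed.

(** * Degrees of the greatest common divisors *)

Lemma dvdp_size_succ (F : fieldType) (u v : {poly F}) :
  u %| v -> size v = (size u).+1 -> exists b, v %= u * ('X - b%:P).
Proof.
case/dvdpP=> q ->.
have [->|u_neq0] := eqVneq u 0; first by rewrite mulr0 size_poly0.
have [->|q_neq0] := eqVneq q 0; first by rewrite mul0r size_poly0.
have := u_neq0; rewrite -size_poly_gt0 => u_gt0.
rewrite size_mul // -(prednK u_gt0) addnS -[_.+2]/(2 + _)%N => /addIn size_q.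
have [b rb] := poly2_root size_q; exists b.
rewrite mulrC eqp_mul2l // eqp_sym -dvdp_size_eqp -?root_factor_theorem //.
by rewrite size_XsubC size_q.
Qed.

(** Sizes are degrees plus one, so the gcds have degrees j + 1 and 1. *)
Lemma gcdp_sizes_absurd (F : finFieldType) (f g : {poly F}) :
    (forall j, 0 < j <= 3 -> size (gcdp f (g ^+ j)) = j.+2)%N ->
    (forall c, c != 0 -> size (gcdp f (g - c%:P)) = 2) ->
  False.
Proof.
move=> size_gcdX size_gcdC.
have size_d1 := size_gcdX 1 isT.
have size_d2 := size_gcdX 2 isT.
have size_d3 := size_gcdX 3 isT.
pose d j := gcdp f (g ^+ j).
have d_dvd j : d j %| d j.+1.
  by rewrite dvdp_gcd dvdp_gcdl exprS dvdp_mull ?dvdp_gcdr.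
have d_root j b : root (d j.+1) b -> root g b.
  by rewrite root_gcd => /andP[_]; rewrite rootE horner_exp expf_eq0 => /andP[].
have [b1 d2E] : exists b, d 2 %= d 1 * ('X - b%:P).
  by apply: dvdp_size_succ; rewrite // size_d1.
have [b2 d3E] : exists b, d 3 %= d 2 * ('X - b%:P).
  by apply: dvdp_size_succ; rewrite // size_d2.
have rootb1 : root (d 2) b1.
  by rewrite (eqp_root d2E) rootM root_XsubC eqxx orbT.
have rootb2 : root (d 3) b2.
  by rewrite (eqp_root d3E) rootM root_XsubC eqxx orbT.
have g_surj c : exists b, g.[b] == c.
  have [->|c_neq0] := eqVneq c 0; first by exists b1; apply: d_root rootb1.
  have [b] := poly2_root (size_gcdC c c_neq0).
  by rewrite root_gcd => /andP[_]; rewrite rootE !hornerE subr_eq0; exists b.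
have g_inj : injective (fun b => g.[b]).
  pose h c := xchoose (g_surj c).
  have hK : cancel h (fun b => g.[b]).
    by move=> c; exact: (eqP (xchooseP (g_surj c))).
  by apply/bij_inj/(bij_can_bij (injF_bij (can_inj hK)) hK).
have g_root b : root g b -> b = b1.
  move=> /rootP gb; apply: g_inj; rewrite gb; symmetry.
  by apply/rootP; apply: d_root rootb1.
have b2E : b2 = b1 by apply/g_root/(d_root 2).
have X_d1 : 'X - b1%:P %| d 1.
  rewrite -root_factor_theorem root_gcd expr1 (d_root 1) // andbT.
  by move: rootb1; rewrite root_gcd => /andP[].
have [b0 d1E] : exists b, d 1 %= ('X - b1%:P) * ('X - b%:P).
  by apply: dvdp_size_succ; rewrite // size_XsubC size_d1.
have b0E : b0 = b1.
  apply/g_root/(d_root 0).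
  by rewrite (eqp_root d1E) rootM !root_XsubC eqxx orbT.
move: d1E d2E d3E; rewrite b2E b0E -expr2; set L := 'X - _ => d1E d2E d3E.
have L4_f : L ^+ 4 %| f.
  apply: dvdp_trans (dvdp_gcdl f (g ^+ 3)); rewrite -/(d 3) (eqp_dvdr _ d3E).
  rewrite exprSr dvdp_mul // (eqp_dvdr _ d2E) exprSr dvdp_mul //.
  by rewrite (eqp_dvdr _ d1E).
have L4_g : L ^+ 4 %| g ^+ 2.
  rewrite (exprM L 2 2) dvdp_exp2r // -(eqp_dvdl _ d1E).
  exact: dvdp_gcdr.
have : L ^+ 4 %| d 2 by rewrite dvdp_gcd L4_f.
by move/dvdp_leq; rewrite -size_poly_gt0 size_d2 size_exp_XsubC => /(_ isT).
Qed.

Theorem mainTheorem4 (F : finFieldType) (k : nat) (a : 'I_k.+1 -> F)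
    (cardF : #|F| = k.+1) (a_bij : bijective a) (a_1 : a ord0 = 0) :
  ~ polynomial_type (jordan_sum a).
Proof.
case=> f [g [f_monic size_f simA]].
have f_neq0 := monic_neq0 f_monic.
(* This applies to X^j and X - c, each with exactly one root in F. *)
have card_nonroot (p : {poly F}) c : root p =1 pred1 c ->
    #|[pred x | ~~ root p x]| = k.
  move=> p_c; rewrite (eq_card (_ : _ =i predC1 c)) ?cardC1 ?cardF // => x.
  by rewrite !inE p_c.
(* Evaluating q at g(C_f) is evaluating q o g at C_f, so the rank of q(A) is
   computed by the companion matrix and by the Jordan blocks. *)
have size_gcd (q : {poly F}) c t :
    root q =1 pred1 c -> size (gcdp 'X^3 q) = t.+1 -> (t <= 3)%N ->
  size (gcdp f (q \Po g)) = t.+2.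
  move=> q_c size_X3 t_le3.
  have := rank_horner_jordan_sum q a_bij a_1.
  rewrite (card_nonroot _ _ q_c) size_X3 (rank_horner_similar _ simA).
  have -> : horner_mx (horner_mx (companion k.+4 f) g) q =
            horner_mx (companion k.+4 f) (q \Po g).
    elim/poly_ind: (q) => [|p x IHp]; first by rewrite comp_poly0 !rmorph0.
    rewrite comp_poly_MXaddC !rmorphD !rmorphM /= IHp !horner_mx_C.
    by rewrite horner_mx_X.
  rewrite (rank_horner_companion f_monic size_f).
  have : (size (gcdp f (q \Po g)) <= k.+1.+4)%N.
    by rewrite -size_f dvdp_leq ?dvdp_gcdl.
  (* The bound on the size keeps the truncated subtraction faithful. *)
  lia.
apply: (@gcdp_sizes_absurd F f g) => [j /andP[j_gt0 j_le3] | c c_neq0].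
  rewrite -comp_Xn_poly; apply: (size_gcd _ 0) => // [x|].
    by rewrite rootE hornerXn expf_eq0 j_gt0.
  by rewrite (eqp_size (dvdp_gcd_idr (dvdp_exp2l _ j_le3))) size_polyXn.
have -> : g - c%:P = ('X - c%:P) \Po g.
  by rewrite comp_polyB comp_polyX comp_polyC.
apply: (size_gcd _ c) => // [x|]; first by rewrite root_XsubC.
apply/eqP; rewrite -/(coprimep _ _) coprimep_XsubC rootE hornerXn.
by rewrite expf_eq0.
Qed.
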